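(* (Bernstein's inequality) Let $k=\mathbb{C}$, let $A=k[\Gamma]$ be a monomial curve, and let $D=\mathrm{Diff}(A)$ be its ring of $k$-linear differential operators. For any finitely generated left $D$-module $M\neq 0$, we have $d(M)\ge 1$.
   Context: Let $k=\mathbb{C}$ and $\mathbb{N}_0=\{0,1,2,\dots\}$. A numerical semigroup is a submonoid $\Gamma\subseteq\mathbb{N}_0$ with $\mathbb{N}_0\setminus\Gamma$ finite; its semigroup algebra $A=k[\Gamma]=\bigoplus_{n\in\Gamma}k\,t^n\subseteq k[t]$ is called a monomial curve. Put $T=k[t,t^{-1}]$ and $\partial=d/dt$. The ring $\mathrm{Diff}(T)=k[t,t^{-1}]\langle\partial\rangle$ is graded by letting $t^n\partial^m$ have degree $n-m$. The ring $D=\mathrm{Diff}(A)$ of $k$-linear differential operators on $A$ is identified with the graded subring $\{P\in\mathrm{Diff}(T):P(A)\subseteq A\}$, and we write $D=\bigoplus_w D_w$. Bernstein filtration: let $D^p_w$ be the space of operators in $D_w$ of order at most $p$, and let $B^n=\sum_{2p+w\le n}D^p_w$ for each integer $n$. Its associated graded ring is the commutative ring $\mathrm{gr}\,D=\bigoplus_n B^n/B^{n-1}$. A filtration of a left $D$-module $M$ is a chain $M_0\subseteq M_1\subseteq\cdots$ of $k$-linear subspaces of $M$ such that $\bigcup_n M_n=M$ and $B^m\cdot M_n\subseteq M_{m+n}$ for all $m,n\ge 0$, with $M_n=0$ for $n<0$. It is good if $\mathrm{gr}\,M=\bigoplus_n M_n/M_{n-1}$ is finitely generated over $\mathrm{gr}\,D$;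 a good filtration exists if and only if $M$ is finitely generated. Dimension: for a finitely generated $M\ne 0$ with good filtration $\{M_n\}$, there are $m\ge 1$ and polynomials $P_0,\dots,P_{m-1}\in\mathbb{Q}[t]$ with $\dim_k M_{nm+r}=P_r(n)$ for all large $n$ and $0\le r<m$, all of the form $P_r(t)=\frac{e}{d!}t^d+\text{(lower degree terms)}$ with $e>0$ a common positive integer and $d$ the Krull dimension of $\mathrm{gr}\,M$. The dimension of $M$ is $d(M)=d$; it is independent of the good filtration. *)

(* Defs.v *)
From HB Require Import structures.
From mathcomp Require Import all_boot all_order all_algebra.
From mathcomp Require Import boolp classical_sets functions cardinality reals.
From mathcomp Require Import complex.

Set Implicit Arguments.
Unset Strict Implicit.
Unset Printing Implicit Defensive.

Import Order.TTheory GRing.Theory Num.Theory.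
Local Open Scope classical_set_scope.
Local Open Scope ring_scope.

Definition numerical_semigroup (G : set nat) : Prop :=
  [/\ G 0%N, (forall a b, G a -> G b -> G (a + b)%N) & finite_set (~` G)].

(* T = K[t, t^-1], as the finitely supported coefficient functions int -> K:
   f stands for \sum_n (f n) t^n. *)
Definition finsupp (K : fieldType) : {pred int -> K^o} :=
  fun f => `[< finite_set [set n | f n != 0] >].

Lemma finsupp_submod_closed (K : fieldType) : submod_closed (@finsupp K).
Proof.
split.
  apply/asboolP; rewrite (_ : [set _ | _] = set0) ?finite_set0 //.
  by apply/seteqP; split => // n /=; rewrite eqxx.
move=> a f g /asboolP Ff /asboolP Fg; apply/asboolP.
apply: (@sub_finite_set _ _ ([set n | f n != 0] `|` [set n | g n != 0])).
  move=> n /= nz; apply: contrapT => /not_orP[].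
  move=> /negP; rewrite negbK => /eqP fn0 /negP; rewrite negbK => /eqP gn0.
  by move: nz; rewrite !fctE fn0 gn0 scaler0 addr0 eqxx.
by rewrite finite_setU.
Qed.

HB.instance Definition _ (K : fieldType) :=
  GRing.isSubmodClosed.Build K (int -> K^o) (@finsupp K)
    (@finsupp_submod_closed K).

Record laurent (K : fieldType) :=
  Laurent { lcoef :> int -> K^o; _ : lcoef \in @finsupp K }.

HB.instance Definition _ (K : fieldType) := [isSub for @lcoef K].
HB.instance Definition _ (K : fieldType) := [Choice of laurent K by <:].
HB.instance Definition _ (K : fieldType) :=
  [SubChoice_isSubLmodule of laurent K by <:].

Lemma finsupp_shift (K : fieldType) (k : int) (f : laurent K) :
  (fun n => f (n - k)) \in @finsupp K.
Proof.
apply/asboolP; case: f => f /= /asboolP Ff.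
apply: (sub_finite_set _ (finite_image (fun n => n + k) Ff)).
by move=> n /= nz; exists (n - k); rewrite ?subrK.
Qed.

(* t^k * f *)
Definition mulT (K : fieldType) (k : int) (f : laurent K) : laurent K :=
  Laurent (finsupp_shift k f).

Lemma finsupp_deriv (K : fieldType) (f : laurent K) :
  (fun n => (n + 1)%:~R * f (n + 1)) \in @finsupp K.
Proof.
apply/asboolP; case: f => f /= /asboolP Ff.
apply: (sub_finite_set _ (finite_image (fun n => n - 1) Ff)).
move=> n /= nz; exists (n + 1); rewrite ?addrK //.
by apply: contraNneq nz => ->; rewrite mulr0.
Qed.

(* d/dt *)
Definition derivT (K : fieldType) (f : laurent K) : laurent K :=
  Laurent (finsupp_deriv f).

(* Diff(T) = K[t, t^-1]<d/dt> (in characteristic 0), inside End_K(T). *)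
Inductive diffT (K : fieldType) : (laurent K -> laurent K) -> Prop :=
| diffT_scal (c : K) : diffT (fun f => c *: f)
| diffT_mul (k : int) : diffT (@mulT K k)
| diffT_deriv : diffT (@derivT K)
| diffT_add P Q : diffT P -> diffT Q -> diffT (P \+ Q)
| diffT_comp P Q : diffT P -> diffT Q -> diffT (P \o Q).

(* The semigroup algebra A = K[G], as a subspace of T. *)
Definition monomial_curve (K : fieldType) (G : set nat) : set (laurent K) :=
  [set f | forall n : int, f n != 0 -> exists2 m : nat, G m & n = m%:Z].

Definition diffA_pred (K : fieldType) (G : set nat) :
    {pred laurent K -> laurent K} :=
  fun P => `[< diffT P /\
               forall f, monomial_curve G f -> monomial_curve G (P f) >].

Lemma diffT_linear (K : fieldType) (P : laurent K -> laurent K) :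
  diffT P -> linear P.
Proof.
elim=> [c|k||P1 P2 _ L1 _ L2|P1 P2 _ L1 _ L2] a f g.
- by rewrite scalerDr !scalerA mulrC.
- by apply: val_inj.
- apply: val_inj; apply/funext => n /=.
  rewrite !fctE /= mulrDr; congr (_ + _).
  by rewrite /GRing.scale /= mulrCA.
- by rewrite /= L1 L2 scalerDr addrACA.
- by rewrite /= L2 L1.
Qed.

Lemma monomial_curve_closed (K : fieldType) (G : set nat) (a : K)
    (f g : laurent K) :
  monomial_curve G f -> monomial_curve G g -> monomial_curve G (a *: f + g).
Proof.
move=> Af Ag n; have [fn0|/Af //] := eqVneq (f n) 0.
have [gn0|/Ag //] := eqVneq (g n) 0.
by rewrite /= !fctE fn0 gn0 scaler0 addr0 eqxx.
Qed.

Lemma diffA_submod_closed (K : fieldType) (G : set nat) :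
  submod_closed (@diffA_pred K G).
Proof.
split.
  apply/asboolP; split; last by move=> f _ n; rewrite /= eqxx.
  rewrite (_ : 0 = (fun f : laurent K => 0 *: f)); first exact: diffT_scal.
  by apply/funext => f; rewrite scale0r.
move=> a P Q /asboolP[DP AP] /asboolP[DQ AQ]; apply/asboolP; split.
  exact: diffT_add (diffT_comp (diffT_scal a) DP) DQ.
by move=> f Af; apply: monomial_curve_closed; [apply: AP|apply: AQ].
Qed.

HB.instance Definition _ (K : fieldType) (G : set nat) :=
  GRing.isSubmodClosed.Build K (laurent K -> laurent K) (@diffA_pred K G)
    (@diffA_submod_closed K G).

(* D = Diff(A), identified with {P in Diff(T) : P(A) is contained in A}. *)
Record diffA (K : fieldType) (G : set nat) :=
  DiffA { dop :> laurent K -> laurent K; _ : dop \in @diffA_pred K G }.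

HB.instance Definition _ (K : fieldType) (G : set nat) :=
  [isSub for @dop K G].
HB.instance Definition _ (K : fieldType) (G : set nat) :=
  [Choice of diffA K G by <:].
HB.instance Definition _ (K : fieldType) (G : set nat) :=
  [SubChoice_isSubLmodule of diffA K G by <:].

Section DiffARing.
Variables (K : fieldType) (G : set nat).
Implicit Types P Q S : diffA K G.

Lemma diffA_one_subproof : (fun f => f) \in @diffA_pred K G.
Proof.
apply/asboolP; split=> //.
rewrite (_ : (fun f => f) = (fun f : laurent K => 1 *: f)).
  exact: diffT_scal.
by apply/funext => f; rewrite scale1r.
Qed.

Lemma diffA_comp_subproof P Q : (P \o Q) \in @diffA_pred K G.
Proof.
case: P => P /= /asboolP[DP AP]; case: Q => Q /= /asboolP[DQ AQ].
by apply/asboolP; split; [apply: diffT_comp|move=> f /AQ /AP].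
Qed.

Lemma diffA_linear P : linear P.
Proof. by case: P => P /= /asboolP[/diffT_linear]. Qed.

Definition diffA_one : diffA K G := DiffA diffA_one_subproof.
Definition diffA_comp P Q : diffA K G := DiffA (diffA_comp_subproof P Q).

Fact diffA_compA : associative diffA_comp.
Proof. by move=> P Q S; apply: val_inj. Qed.

Fact diffA_comp1l : left_id diffA_one diffA_comp.
Proof. by move=> P; apply: val_inj. Qed.

Fact diffA_comp1r : right_id diffA_one diffA_comp.
Proof. by move=> P; apply: val_inj. Qed.

Fact diffA_compDl : left_distributive diffA_comp +%R.
Proof. by move=> P Q S; apply: val_inj. Qed.

Fact diffA_compDr : right_distributive diffA_comp +%R.
Proof.
move=> P Q S; apply: val_inj; apply/funext => f /=.
by rewrite !fctE /= -[Q f]scale1r diffA_linear !scale1r.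
Qed.

Fact diffA_one_neq0 : diffA_one != 0.
Proof.
have Fd : (fun n : int => (n == 0)%:R) \in @finsupp K.
  apply/asboolP; apply: (sub_finite_set _ (finite_set1 (0 : int))) => n /=.
  by case: (n =P 0) => // _ /eqP; case.
apply/eqP => /(congr1 (fun P : diffA K G => P (Laurent Fd) 0)) /= /eqP.
by rewrite oner_eq0.
Qed.

HB.instance Definition _ := GRing.Zmodule_isNzRing.Build (diffA K G)
  diffA_compA diffA_comp1l diffA_comp1r diffA_compDl diffA_compDr
  diffA_one_neq0.

Fact diffA_scaleAl (c : K) P Q : c *: (P * Q) = c *: P * Q.
Proof. by apply: val_inj. Qed.

HB.instance Definition _ :=
  GRing.Lmodule_isLalgebra.Build K (diffA K G) diffA_scaleAl.

End DiffARing.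

(* D^p_w: as t^n (d/dt)^m has degree n - m, the elements of Diff(T) of degree w
   and order at most p are the combinations of t^(w + m) (d/dt)^m, m <= p. *)
Definition Dpw (K : fieldType) (G : set nat) (p : nat) (w : int) :
    set (diffA K G) :=
  [set P | exists c : 'I_p.+1 -> K, forall f : laurent K,
     P f = \sum_(m < p.+1) c m *: mulT (w + m%:Z) (iter m (@derivT K) f)].

(* The Bernstein filtration: the sum of subspaces of the D^p_w, 2p + w <= n. *)
Definition bernstein (K : fieldType) (G : set nat) (n : int) :
    set (diffA K G) :=
  [set P | exists s : seq (diffA K G), P = \sum_(Q <- s) Q /\
     forall Q, Q \in s ->
       exists (p : nat) (w : int), 2 * p%:Z + w <= n /\ @Dpw K G p w Q].

Definition finitely_generated (D : pzRingType) (M : lmodType D) : Prop :=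
  exists (r : nat) (g : 'I_r -> M), forall x : M,
    exists c : 'I_r -> D, x = \sum_(i < r) c i *: g i.

Section Modules.
Variables (K : fieldType) (G : set nat) (M : lmodType (diffA K G)).

(* The K-vector space structure of M is the restriction of its D-module
   structure along c |-> c%:A. *)
Definition subspace (U : set M) : Prop :=
  U 0 /\ forall (c : K) x y, U x -> U y -> U (c%:A *: x + y).

(* dim_K U = k: U has a basis b_0, ..., b_(k-1). *)
Definition has_dim (U : set M) (k : nat) : Prop :=
  exists b : 'I_k -> M,
    (forall x : M, U x <-> exists c : 'I_k -> K,
       x = \sum_(i < k) (c i)%:A *: b i) /\
    (forall c : 'I_k -> K, \sum_(i < k) (c i)%:A *: b i = 0 ->
       forall i, c i = 0).

Definition filtration (F : nat -> set M) : Prop :=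
  [/\ forall n, subspace (F n),
      forall n, F n `<=` F n.+1,
      forall x, exists n, F n x
    & forall (m n : nat) (P : diffA K G) (x : M),
        @bernstein K G m%:Z P -> F n x -> F (m + n)%N (P *: x)].

(* M_(n-1), with M_(-1) = 0 *)
Definition fil_pred (F : nat -> set M) (n : nat) : set M :=
  if n is n'.+1 then F n' else [set 0].

(* gr D and gr M are handled through representatives: an element of gr M is
   given by a finitely supported family (x_n) with x_n in M_n, and (x_n), (y_n)
   give the same element iff x_n - y_n lies in M_(n-1) for all n; likewise for
   gr D.  Since B^n = 0 for n < 0 (an operator on A of degree -w has order at
   least w), indices in nat suffice for gr D. *)
Definition gr_rep (V : zmodType) (F : nat -> set V) (x : nat -> V) : Prop :=
  (forall n, F n (x n)) /\ exists N : nat, forall n, (N <= n)%N -> x n = 0.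

Definition gr_eq (F : nat -> set M) (x y : nat -> M) : Prop :=
  forall n, fil_pred F n (x n - y n).

Definition gr_act (b : nat -> diffA K G) (x : nat -> M) : nat -> M :=
  fun n => \sum_(j < n.+1) b (n - j)%N *: x j.

Definition good_filtration (F : nat -> set M) : Prop :=
  filtration F /\
  exists (r : nat) (g : 'I_r -> nat -> M),
    (forall i, gr_rep F (g i)) /\
    forall x, gr_rep F x ->
      exists b : 'I_r -> nat -> diffA K G,
        (forall i, gr_rep (fun n : nat => @bernstein K G n%:Z) (b i)) /\
        gr_eq F x (fun n => \sum_(i < r) gr_act (b i) (g i) n).

(* d(M) = d, as a relation: for some good filtration, dim M_(n m + r) = P_r(n)
   for n large, where all the P_r have leading term (e / d!) t^d, e > 0.  Such
   a d is the Krull dimension of gr M, and is the same for every good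
   filtration. *)
Definition is_dimension (d : nat) : Prop :=
  exists F : nat -> set M, good_filtration F /\
  exists (m : nat) (P : 'I_m -> {poly rat}) (e : nat),
    [/\ (0 < m)%N, (0 < e)%N,
        forall r, size (P r) = d.+1 /\ lead_coef (P r) = e%:R / (d`!)%:R
      & exists N : nat, forall (n : nat) (r : 'I_m), (N <= n)%N ->
          exists k : nat,
            has_dim (F (n * m + r)%N) k /\ (P r).[n%:R] = k%:R].

End Modules.

(* Main.v *)
Require Import Defs.
From mathcomp Require Import all_boot all_order all_algebra.
From mathcomp Require Import classical_sets reals complex.
From mathcomp Require Import boolp functions cardinality.

(** Let E = t d/dt be the Euler operator.  If d(M) = 0, the dimensions of the
    pieces of a good filtration are eventually constant along multiples of m,
    so the filtration is stationary and M is finite-dimensional over K.  The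
    inequality thus says that D has no nonzero finite-dimensional module.

    Suppose M is finite-dimensional, and let I be its annihilator, a two-sided
    ideal.  By Cayley-Hamilton, I contains p(E) for some p <> 0
    ([annih_char_poly]).  It remains to see that such an ideal contains 1, using
    only the homogeneous operators t^w p(E) and the rule
    p(E) t^w = t^w p(E + w).

    First, for k > 0 in G, the commutator of t^k with t^w p(E) is
    t^(w+k) (p(E) - p(E + k)) up to sign; in characteristic 0 this lowers the
    degree of a nonconstant p without turning it into 0.  Iterating leads to a
    pure power t^m in I with m in G ([annih_tpow]).

    Next, an operator t^(-m) q(E) preserves A as soon as q vanishes at each g in
    G with g - m not in G; there are finitely many such g, because G contains
    all large integers, so q can be taken to have exactly these roots.
    Multiplying it with t^m on both sides puts q(E) and q(E + m) in I.  The
    roots of q(z) lie in G, those of q(z + m) are integers outside G, so both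
    are coprime, and a Bezout relation gives 1 in I ([annih_tpow1]). *)

Set Implicit Arguments.
Unset Strict Implicit.
Unset Printing Implicit Defensive.

Import Order.TTheory GRing.Theory Num.Theory.
Local Open Scope classical_set_scope.
Local Open Scope ring_scope.

(** * Homogeneous operators *)

Section HomogeneousOperators.
Variable K : fieldType.
Implicit Types (f : laurent K) (p q : {poly K}) (v w : int).

Lemma finsupp_diag p f : (fun n : int => p.[n%:~R] * f n) \in @finsupp K.
Proof.
apply/asboolP; case: f => f /= /asboolP; apply: sub_finite_set => n /=.
by apply: contraNneq => ->; rewrite mulr0.
Qed.

(** The operator t^w p(E), which maps t^n to p(n) t^(n + w). *)
Definition homogT w p f : laurent K := mulT w (Laurent (finsupp_diag p f)).

Lemma diffT_homogT w p : diffT (homogT w p).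
Proof.
suff D0 : diffT (homogT 0 p).
  rewrite (_ : homogT w p = mulT w \o homogT 0 p).
    by apply: diffT_comp => //; apply: diffT_mul.
  by apply/funext => f; apply: val_inj; apply/funext => n /=; rewrite subr0.
elim/poly_ind: p => [|p c IHp].
  rewrite (_ : homogT 0 0 = fun f => 0 *: f); first exact: diffT_scal.
  apply/funext => f; apply: val_inj; apply/funext => n /=.
  by rewrite horner0 mul0r scale0r.
rewrite (_ : homogT 0 _ =
    (homogT 0 p \o (@mulT K 1 \o @derivT K)) \+ (fun f => c *: f)).
  apply: diffT_add; last exact: diffT_scal.
  apply: diffT_comp => //; apply: diffT_comp; first exact: diffT_mul.
  exact: diffT_deriv.
apply/funext => f; apply: val_inj; apply/funext => n /=.
rewrite !fctE /= !subr0 hornerMXaddC subrK mulrDl -mulrA.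
by [].
Qed.

(** The rule q(E) t^w = t^w q(E + w), on which everything below rests. *)
Lemma homogT_comp v w p q :
  homogT v q \o homogT w p = homogT (v + w) ((q \Po ('X + w%:~R%:P)) * p).
Proof.
apply/funext => f; apply: val_inj; apply/funext => n /=.
by rewrite hornerM horner_comp hornerD hornerX hornerC opprD addrA -intrD subrK
  [LHS]mulrA.
Qed.

Lemma homogTD w p q : homogT w (p + q) = homogT w p + homogT w q.
Proof.
apply/funext => f; apply: val_inj; apply/funext => n /=.
by rewrite hornerD mulrDl.
Qed.

Lemma homogTC (c : K) f : homogT 0 c%:P f = c *: f.
Proof.
by apply: val_inj; apply/funext => n /=; rewrite hornerC subr0.
Qed.

(** The condition for t^w p(E) to preserve A: a monomial t^g of A may leave A
    only if p(g) = 0. *)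
Definition stable (G : set nat) w p := forall g : nat, G g ->
  p.[g%:R] != 0 -> exists2 m : nat, G m & g%:Z + w = m%:Z.

Lemma stable0 G p : stable G 0 p.
Proof. by move=> g Gg _; exists g; rewrite ?addr0. Qed.

Lemma homogT_diffA (G : set nat) w p :
  stable G w p -> homogT w p \in @diffA_pred K G.
Proof.
move=> Gwp; apply/asboolP; split; first exact: diffT_homogT.
move=> f Af n /= nz.
have /Af[g Gg ng] : f (n - w) != 0.
  by apply: contraNneq nz => ->; rewrite mulr0.
rewrite -[n](subrK w) ng; apply: Gwp => //.
by apply: contraNneq nz; rewrite ng => ->; rewrite mul0r.
Qed.

Definition homogA (G : set nat) w p (Gwp : stable G w p) : diffA K G :=
  DiffA (homogT_diffA Gwp).

End HomogeneousOperators.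

(** * Homogeneous elements of the annihilator of a module *)

Section Annihilator.
Variables (K : fieldType) (G : set nat) (M : lmodType (diffA K G)).
Implicit Types (p q : {poly K}) (v w : int).

(** The element of D is quantified existentially, so that rewriting w and p does
    not involve proofs that t^w p(E) preserves A. *)
Definition annih w p : Prop :=
  exists2 P : diffA K G, dop P = homogT w p & forall x : M, P *: x = 0.

Lemma annihD w p q : annih w p -> annih w q -> annih w (p + q).
Proof.
move=> [P eP P0] [Q eQ Q0]; exists (P + Q).
  by rewrite homogTD -eP -eQ.
by move=> x; rewrite scalerDl P0 Q0 addr0.
Qed.

Lemma annihMl v w p q : stable G v q -> annih w p ->
  annih (v + w) ((q \Po ('X + w%:~R%:P)) * p).
Proof.
move=> Gvq [P eP P0]; exists (homogA Gvq * P).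
  by rewrite -homogT_comp -eP.
by move=> x; rewrite -scalerA P0 scaler0.
Qed.

Lemma annihMr v w p q : stable G v q -> annih w p ->
  annih (w + v) ((p \Po ('X + v%:~R%:P)) * q).
Proof.
move=> Gvq [P eP P0]; exists (P * homogA Gvq).
  by rewrite -homogT_comp -eP.
by move=> x; rewrite -scalerA P0.
Qed.

Lemma annihZ w p (c : K) : annih w p -> annih w (c *: p).
Proof.
move=> wp; have := annihMl (stable0 (p := c%:P)) wp.
by rewrite add0r comp_polyC mul_polyC.
Qed.

Lemma annih1_trivial : annih 0 1 -> forall x : M, x = 0.
Proof.
move=> [P eP P0] x; rewrite -[x]scale1r -(P0 x); congr (_ *: _).
by apply: val_inj; apply/funext => f /=; rewrite eP homogTC scale1r.
Qed.

End Annihilator.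

(** * Shifted differences of polynomials in characteristic 0 *)

Section PolynomialShift.
Variable K : numFieldType.

Lemma size_shift_diff (p : {poly K}) (a : K) : (1 < size p)%N ->
  (size (p - (p \Po ('X + a%:P)))%R < size p)%N.
Proof.
move=> p1.
have sz : size (p \Po ('X + a%:P)) = size p.
  by rewrite size_comp_poly2 // size_XaddC.
have lc : lead_coef (p \Po ('X + a%:P)) = lead_coef p.
  by rewrite lead_coef_comp ?size_XaddC // lead_coefXaddC expr1n mulr1.
rewrite -[X in (_ < X)%N](prednK (ltnW p1)) ltnS.
apply/leq_sizeP => j; rewrite leq_eqVlt coefB => /orP[/eqP <-|lt].
  by move: lc; rewrite !lead_coefE sz => ->; rewrite subrr.
have le : (size p <= j)%N by rewrite -(prednK (ltnW p1)).
by rewrite !nth_default ?subrr ?sz.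
Qed.

(** A polynomial with p(z + k) = p(z) takes the value p(0) at all multiples of
    k, which are infinitely many in characteristic 0. *)
Lemma shift_diff_neq0 (p : {poly K}) (k : nat) : (0 < k)%N ->
  (1 < size p)%N -> p - (p \Po ('X + k%:R%:P)) != 0.
Proof.
move=> k0 p1; apply/eqP => /subr0_eq pk.
have val j : p.[(j * k)%:R] = p.[0].
  elim: j => [|j <-] //.
  by rewrite mulSn addnC natrD [in RHS]pk horner_comp !hornerE.
pose q := p - p.[0]%:P.
have q0 : q != 0.
  apply: contraTneq p1 => /subr0_eq ->.
  by rewrite -leqNgt size_polyC leq_b1.
pose s := [seq (j * k)%:R : K | j <- iota 0 (size q)].
have us : uniq s.
  rewrite map_inj_uniq ?iota_uniq // => i j /eqP.
  by rewrite eqr_nat eqn_pmul2r // => /eqP.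
have rs : all (root q) s.
  apply/allP => _ /mapP[j _ ->].
  by rewrite rootE /q !hornerE val subrr.
by have := max_poly_roots q0 rs us; rewrite size_map size_iota ltnn.
Qed.

End PolynomialShift.

(** * The annihilator of a nonzero module contains no nonzero p(E) *)

Section Simplicity.
Variables (K : numFieldType) (G : set nat) (M : lmodType (diffA K G)).
Hypothesis hG : numerical_semigroup G.

Lemma semigroup_conductor : exists c : nat, forall n, (c <= n)%N -> G n.
Proof.
case: hG => _ _ /finite_seqP[s sE].
exists (\max_(i <- s) i.+1)%N => n cn; apply: contrapT => nG.
have ns : n \in s by have : [set` s] n by rewrite -sE.
have n_max : (n < \max_(i <- s) i.+1)%N by apply: leq_bigmax_seq ns _.
by have := leq_trans n_max cn; rewrite ltnn.
Qed.

Lemma stable_tpow (k : nat) : G k -> stable G k%:Z (1 : {poly K}).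
Proof.
case: hG => _ GD _ Gk g Gg _; exists (g + k)%N; first exact: GD.
by rewrite PoszD.
Qed.

(** Commuting with t^k replaces a nonconstant p by a nonzero polynomial of lower
    degree, and a nonzero constant can be divided out. *)
Lemma annih_tpow (w : int) (p : {poly K}) (k : nat) : G k -> (0 < k)%N ->
  p != 0 -> annih M w p -> exists j : nat, annih M (w + (j * k)%:Z) 1.
Proof.
move=> Gk k0; move: {-1}(size p) (leqnn (size p)) => n.
elim: n p w => [|n IHn] p w; first by rewrite leqn0 size_poly_eq0 => ->.
move=> pn p0 wp; have [p1|p1] := leqP (size p) 1.
  exists 0%N; rewrite mul0n addr0; have := annihZ (p`_0)^-1 wp.
  rewrite {2}(size1_polyC p1) -mul_polyC -polyCM mulVf //.
  by apply: contraNneq p0 => p00; rewrite (size1_polyC p1) p00.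
have [] := IHn (p - (p \Po ('X + k%:R%:P))) (w + k%:Z).
- by rewrite -ltnS; apply: leq_trans (size_shift_diff _ p1) pn.
- exact: shift_diff_neq0.
- apply: annihD.
    have := annihMl (stable_tpow Gk) wp.
    by rewrite comp_polyC mul1r addrC.
  have := annihZ (-1) (annihMr (stable_tpow Gk) wp).
  by rewrite mulr1 scaleN1r.
by move=> j wj; exists j.+1; rewrite mulSn PoszD addrA.
Qed.

(** The g in G with g - m outside G; when c is a conductor of G they are all less
    than m + c.  The subtraction is avoided since that of nat is truncated. *)
Definition lowering_roots (c m : nat) : seq nat :=
  [seq g <- iota 0 (m + c) |
    `[< G g /\ ~ exists2 h, G h & g = (h + m)%N >]].

(** When c is a conductor of G, the operators t^(-m) p(E) that preserve A are
    those with p a multiple of this polynomial. *)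
Definition lowering_poly (c m : nat) : {poly K} :=
  \prod_(g <- lowering_roots c m) ('X - g%:R%:P).

Lemma stable_lowering (c m : nat) : (forall n, (c <= n)%N -> G n) ->
  stable G (- m%:Z) (lowering_poly c m).
Proof.
move=> cG g Gg; have [[h Gh ->] _|ng] := pselect (exists2 h, G h & g = (h + m)%N).
  by exists h => //; rewrite PoszD addrK.
rewrite horner_prod prodf_seq_neq0 => /allP/(_ g)/=.
rewrite hornerXsubC subrr eqxx => gr; exfalso.
suff /gr : g \in lowering_roots c m by [].
rewrite mem_filter mem_iota /= add0n; apply/andP; split; first exact/asboolP.
rewrite ltnNge; apply/negP => le; apply: ng; exists (g - m)%N.
  by apply: cG; rewrite leq_subRL // (leq_trans (leq_addr _ _) le).
by rewrite subnK // (leq_trans (leq_addr _ _) le).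
Qed.

(** If g is a root of q and so is g + m, then (g + m) - m = g lies in G, against
    the choice of the root g + m. *)
Lemma coprimep_lowering (c m : nat) :
  coprimep (lowering_poly c m \Po ('X + m%:R%:P)) (lowering_poly c m).
Proof.
rewrite {2}/lowering_poly big_seq; apply: (big_ind (coprimep _)).
- exact: coprimep1.
- by move=> p q; rewrite coprimepMr => -> ->.
move=> g; rewrite mem_filter => /andP[/asboolP[Gg _] _].
rewrite coprimep_XsubC rootE horner_comp hornerD hornerX hornerC -natrD.
rewrite horner_prod prodf_seq_neq0; apply/allP => h /=.
rewrite mem_filter => /andP[/asboolP[_ nh] _].
rewrite hornerXsubC subr_eq0 eqr_nat; apply/eqP => gh.
by apply: nh; exists g.
Qed.

Lemma annih_tpow1 (m : nat) : G m -> annih M m%:Z 1 -> annih M 0 1.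
Proof.
move=> Gm m1; have [c cG] := semigroup_conductor.
have /Bezout_eq1_coprimepP[[u v] /= uv] := coprimep_lowering c m.
have := annihMl (stable_lowering (m := m) cG) m1.
rewrite mulr1 addNr => /(annihMl (stable0 (p := u))).
rewrite addr0 addr0 comp_polyXr.
have := annihMr (stable_lowering (m := m) cG) m1.
rewrite comp_polyC mul1r subrr => /(annihMl (stable0 (p := v))).
rewrite addr0 addr0 comp_polyXr => av au.
by rewrite -uv; apply: annihD.
Qed.

Lemma annih_trivial (p : {poly K}) : p != 0 -> annih M 0 p ->
  forall x : M, x = 0.
Proof.
move=> p0 ap; apply: annih1_trivial; have [c cG] := semigroup_conductor.
have [] := annih_tpow (cG _ (leqnSn c)) _ p0 ap => // j.
rewrite add0r; apply: annih_tpow1.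
elim: j => [|j IHj]; first by case: hG.
by case: hG => _ GD _; rewrite mulSn; apply: GD => //; apply: cG.
Qed.

End Simplicity.

(** * Finite-dimensional modules *)

Section FiniteDimension.
Variables (K : fieldType) (G : set nat) (M : lmodType (diffA K G)).

Definition lincomb k (v : 'rV[K]_k) (b : 'I_k -> M) : M :=
  \sum_i (v 0 i)%:A *: b i.

Lemma lincombD k (u v : 'rV_k) b :
  lincomb (u + v) b = lincomb u b + lincomb v b.
Proof.
rewrite /lincomb -big_split; apply: eq_bigr => i _.
by rewrite mxE scalerDl scalerDl.
Qed.

Lemma lincomb_mulmx k l (b : 'I_k -> M) (a : 'I_l -> M) (C : 'M_(k, l)) v :
  (forall i, b i = lincomb (row i C) a) -> lincomb v b = lincomb (v *m C) a.
Proof.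
move=> bC; rewrite /lincomb.
under eq_bigr => i _ do rewrite bC scaler_sumr.
rewrite exchange_big; apply: eq_bigr => j _ /=.
rewrite mxE scaler_suml scaler_suml; apply: eq_bigr => i _.
by rewrite mxE scalerA -scalerAl mul1r scalerA.
Qed.

Lemma lincombZ k (P : diffA K G) v (b : 'I_k -> M) :
  P *: lincomb v b = lincomb v (fun i => P *: b i).
Proof.
rewrite scaler_sumr; apply: eq_bigr => i _; rewrite !scalerA.
congr (_ *: _); apply: val_inj; apply/funext => f /=.
exact: scalable_linear (diffA_linear P) _ _.
Qed.

(** The matrix expressing a basis of U in one of V is square with independent
    rows, hence invertible. *)
Lemma has_dim_eq (U V : set M) k :
  U `<=` V -> has_dim U k -> has_dim V k -> V `<=` U.
Proof.
move=> UV [b [Ub bfree]] [a [Va _]].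
have rowE l (c : 'I_l -> K) (d : 'I_l -> M) :
    \sum_(i < l) (c i)%:A *: d i = lincomb (\row_i c i) d.
  by apply: eq_bigr => i _; rewrite mxE.
have Vb i : exists c : 'rV_k, b i = lincomb c a.
  have /UV/Va[c ->] : U (b i).
    apply/Ub; exists (fun j => (j == i)%:R); rewrite (bigD1 i) //= eqxx.
    rewrite !scale1r big1 ?addr0 // => j /negPf ->.
    by rewrite !scale0r.
  by exists (\row_j c j).
have [c bc] := choice Vb.
pose C := \matrix_i c i.
have bC i : b i = lincomb (row i C) a by rewrite rowK.
have Cfree : row_free C.
  apply: inj_row_free => v vC0; apply/rowP => i; rewrite mxE.
  apply: (bfree (v 0)); rewrite -/(lincomb v b) (lincomb_mulmx _ bC) vC0.
  by rewrite /lincomb big1 // => j _; rewrite mxE !scale0r.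
rewrite row_free_unit in Cfree.
move=> x /Va[e ->]; apply/Ub; exists ((\row_i e i *m invmx C) 0).
by rewrite -/(lincomb _ b) (lincomb_mulmx _ bC) mulmxKV // rowE.
Qed.

(** Let A be the matrix of E on the spanning family b.  Then p(E) acts on b by
    p(A), for all p, and the characteristic polynomial of A kills A. *)
Lemma annih_char_poly n (b : 'I_n.+1 -> M) :
  (forall x, exists v, x = lincomb v b) ->
  exists2 p : {poly K}, p != 0 & annih M 0 p.
Proof.
move=> span; pose E : diffA K G := homogA (stable0 (p := 'X)).
have [a aE] := choice (fun i => span (E *: b i)).
pose A := \matrix_i a i.
have EA i : E *: b i = lincomb (row i A) b by rewrite rowK.
have lift p : exists2 Q : diffA K G, dop Q = homogT 0 p &
    forall i, Q *: b i = lincomb (row i (horner_mx A p)) b.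
  elim/poly_ind: p => [|p c [Q eQ QA]].
    exists 0.
      by apply/funext => f; rewrite -polyC0 homogTC scale0r.
    move=> i; rewrite scale0r rmorph0 /lincomb big1 // => j _.
    by rewrite !mxE !scale0r.
  exists (Q * E + c%:A).
    rewrite homogTD; congr (_ + _).
      rewrite /= eQ homogT_comp; congr homogT.
      by rewrite addr0 comp_polyXr.
    by apply/funext => f; rewrite homogTC.
  move=> i; rewrite scalerDl -scalerA EA lincombZ (lincomb_mulmx _ QA).
  rewrite rmorphD /= horner_mx_C mulrC rmorphM /= horner_mx_X.
  rewrite linearD lincombD -mulmxE /= row_mul; congr (_ + _).
  rewrite /lincomb (bigD1 i) //= !mxE eqxx mulr1n big1 ?addr0 // => j ji.
  by rewrite !mxE eq_sym (negPf ji) mulr0n !scale0r.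
exists (char_poly A); first exact/monic_neq0/char_poly_monic.
have [Q eQ QA] := lift (char_poly A); exists Q => // x.
have [v ->] := span x; rewrite lincombZ (lincomb_mulmx (a := b) (C := 0)) => [|i].
  by rewrite mulmx0 /lincomb big1 // => i _; rewrite mxE !scale0r.
by rewrite QA Cayley_Hamilton.
Qed.

End FiniteDimension.

(** * Bernstein's inequality *)

Theorem proposition4 (R : realType) (G : set nat) (hG : numerical_semigroup G)
    (M : lmodType (diffA R[i]%C G)) (hfg : finitely_generated M)
    (hM : exists x : M, x <> 0%R) (d : nat) (hd : is_dimension M d) :
  (1 <= d)%N.
Proof.
rewrite lt0n; apply/eqP => d0; case: hM => x; apply.
move: hd; rewrite d0 => -[F [[[_ Fmono Fex _] _] [m [P [e [m0 e0 PE [N FN]]]]]]].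
(* In degree 0 the dimension polynomials are constant, equal to e / 0! = e;
   along the residue class 0 modulo m, dim F (n * m) is thus e for large n. *)
have dimF n : (N <= n)%N -> has_dim (F (n * m)%N) e.
  move=> Nn; have [k [Fk]] := FN n (Ordinal m0) Nn.
  have [/eqP/size_poly1P[c _ Pc] lc] := PE (Ordinal m0).
  move: lc; rewrite Pc hornerC lead_coefC divr1 => ->.
  by move=> /eqP; rewrite eqr_nat => /eqP ->; rewrite -[(n * m)%N]addn0.
have Fle i j : (i <= j)%N -> F i `<=` F j.
  elim: j => [|j IHj]; first by rewrite leqn0 => /eqP ->.
  rewrite leq_eqVlt => /predU1P[-> //|]; rewrite ltnS => /IHj.
  by move=> Fij y /Fij /Fmono.
(* F (N * m) and F ((N + n) * m) have the same dimension, hence are equal. *)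
have FT y : F (N * m)%N y.
  have [n Fny] := Fex y.
  have le : (N * m <= (N + n) * m)%N by rewrite leq_mul2r leq_addr orbT.
  apply: (has_dim_eq (Fle _ _ le) (dimF _ _) (dimF _ _)); rewrite ?leq_addr //.
  by apply: Fle Fny; rewrite (leq_trans (leq_addl N n)) // leq_pmulr.
have [b [Fb _]] := dimF N (leqnn N).
case: e e0 b Fb {PE dimF} => // e _ b Fb.
have span y : exists v, y = lincomb v b.
  have /Fb[c ->] := FT y; exists (\row_i c i).
  by apply: eq_bigr => i _; rewrite mxE.
have [p p0 ap] := annih_char_poly span.
exact: (annih_trivial hG p0 ap).
Qed.
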